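(* Let $n$ be a positive integer with $n\equiv 0\pmod 4$ and let $k$ be an integer with $1\le k\le\frac n2$. Let $\Gamma_{\mathrm{III}}^k(n)$ be the graph whose vertices are all Type III codes of length $n$, two vertices being joined by an edge if and only if they are $k$-neighbors. Then: (a) the number of vertices of $\Gamma_{\mathrm{III}}^k(n)$ is $2\prod_{i=1}^{\frac n2-1}(3^i+1)$; (b) $\Gamma_{\mathrm{III}}^k(n)$ is regular of degree $$\frac{\prod_{i=0}^{k-1}\left(3^{\,n-1-i}-3^{\frac n2-1}\right)}{\prod_{j=0}^{k-1}\left(3^{\frac n2}-3^{\frac n2-1-j}\right)};$$ (c) the number of edges of $\Gamma_{\mathrm{III}}^k(n)$ is $$\left(\prod_{i=1}^{\frac n2-1}(3^i+1)\right)\frac{\prod_{i=0}^{k-1}\left(3^{\,n-1-i}-3^{\frac n2-1}\right)}{\prod_{j=0}^{k-1}\left(3^{\frac n2}-3^{\frac n2-1-j}\right)}.$$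
   Context: Equip $\mathbb{F}_3^n$ with the inner product $u\cdot v=\sum_{i=1}^n u_iv_i$. A code of length $n$ over $\mathbb{F}_3$ is a linear subspace $C\subseteq\mathbb{F}_3^n$; its dual is $C^\perp=\{v\in\mathbb{F}_3^n : u\cdot v=0 \text{ for all } u\in C\}$, and $C$ is self-dual if $C=C^\perp$ (so $\dim C=n/2$). The weight of a vector is its number of nonzero coordinates. A Type III code is a self-dual code over $\mathbb{F}_3$ in which every codeword has weight divisible by $3$. Codes are counted as subspaces (not up to equivalence). Two self-dual codes $C,D$ of length $n$ are $k$-neighbors if $\dim(C\cap D)=\frac n2-k$. *)

(* Defs.v *)
From HB Require Import structures.
From mathcomp Require Import all_boot all_order all_algebra.

Set Implicit Arguments.
Unset Strict Implicit.
Unset Printing Implicit Defensive.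

Import GRing.Theory.
Local Open Scope ring_scope.

(** The library gives [{vspace vT}] a choice structure only; over a finite field
    it is a subtype of a finite type of matrices, hence finite. *)
Section VspaceFinite.

Import VectorInternalTheory.
Variables (K : finFieldType) (vT : vectType K).

HB.instance Definition _ := [Countable of {vspace vT} by <:].
HB.instance Definition _ := [Finite of {vspace vT} by <:].

End VspaceFinite.

Record sgraph := SGraph {
  vertex :> finType;
  adj : rel vertex;
  adj_sym : symmetric adj;
  adj_irr : irreflexive adj }.

Arguments adj {s}.

Definition degree (G : sgraph) (x : G) : nat := #|[set y | adj x y]|.

Definition regular (G : sgraph) (d : nat) : Prop := forall x : G, degree x = d.

Definition edges (G : sgraph) : {set {set G}} :=
  [set [set p.1; p.2] | p : G * G & adj p.1 p.2].

Notation code n := {vspace 'rV['F_3]_n}.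

Definition inner (n : nat) (u v : 'rV['F_3]_n) : 'F_3 :=
  \sum_(i < n) u 0 i * v 0 i.

Definition dual (n : nat) (C : code n) : {set 'rV['F_3]_n} :=
  [set v | [forall u in C, inner u v == 0]].

Definition self_dual (n : nat) (C : code n) : bool := [set v in C] == dual C.

Definition weight (n : nat) (v : 'rV['F_3]_n) : nat := #|[set i | v 0 i != 0]|.

Definition typeIII (n : nat) (C : code n) : bool :=
  self_dual C && [forall v in C, (3 %| weight v)%N].

(** [\dim (C :&: D) = n/2 - k], written without truncated subtraction. *)
Definition k_neighbors (n k : nat) (C D : code n) : bool :=
  (\dim (C :&: D) + k == n./2)%N.

Definition typeIII_code (n : nat) : finType := {C : code n | typeIII C}.

(** Loops are excluded explicitly so that the graph is simple for every [k];
    for [1 <= k] the condition [C != D] is implied by [k_neighbors], a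
    self-dual code having dimension [n/2]. *)
Definition GammaIII_adj (n k : nat) : rel (typeIII_code n) :=
  fun C D => (C != D) && k_neighbors k (val C) (val D).

Lemma GammaIII_adj_sym n k : symmetric (@GammaIII_adj n k).
Proof. by move=> C D; rewrite /GammaIII_adj eq_sym /k_neighbors capvC. Qed.

Lemma GammaIII_adj_irr n k : irreflexive (@GammaIII_adj n k).
Proof. by move=> C; rewrite /GammaIII_adj eqxx. Qed.

Definition GammaIII (n k : nat) : sgraph :=
  SGraph (@GammaIII_adj_sym n k) (@GammaIII_adj_irr n k).

(* Main.v *)
From HB Require Import structures.
Require Import Defs.
From mathcomp Require Import all_boot all_order all_algebra all_field.
From mathcomp Require Import ring zify.

Set Implicit Arguments.
Unset Strict Implicit.
Unset Printing Implicit Defensive.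

Import Order.TTheory GRing.Theory Num.Theory.
Local Open Scope ring_scope.

(** A vector over F_3 satisfies v.v = weight v mod 3, so the Type III codes are
    exactly the subspaces C of F_3^n with C^perp = C: the Lagrangians of the dot
    product. Fix one of them, C, put m = n/2, q = 3, and let N_k be the number
    of Lagrangians D with dim (C :&: D) = m - k, the sphere of radius k around
    C. Part (b) is the value of N_k, independent of C.

    The recursion from N_k to N_(k+1) counts the pairs (D, E) with D in the
    sphere of radius k, E in the sphere of radius k + 1, and D :&: E a
    hyperplane of both. The tool is Kneser's neighbour construction: an
    isotropic vector v outside a Lagrangian D lies in exactly one Lagrangian
    meeting D in a hyperplane, namely (D :&: v^perp) + <v>.
    - Given D, a vector v outside C + D lies in D + E for exactly one E, and
      each E is reached from the q^(m+1) - q^m vectors of D + E outside D; so D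
      has (q^(2m) - q^(m+k)) / (q^(m+1) - q^m) partners [card_sphere_up].
    - Given E, a vector v of C outside E lies in exactly one D, and each D is
      reached from the vectors of C :&: D outside C :&: E; so E has
      (q^m - q^(m-k-1)) / (q^(m-k) - q^(m-k-1)) partners [card_sphere_down].
    What makes the distances match is [adjacent_step]: passing from D to an
    adjacent E either keeps all of C :&: D or loses exactly one dimension of it,
    and in the latter case nothing new is gained.

    Starting from N_0 = 1 this gives
    N_k = prod_(i < k) (q^m - q^i) / (q^(i+1) - 1) [card_sphere], which is the
    degree in (b). Part (a) is the sum of the N_k over all k, evaluated by the
    q-binomial theorem at 1 [qbinomial_sum] as prod_(i < m) (1 + q^i), whose
    factor for i = 0 is the 2 in front. This needs one Lagrangian to
    start from, and here 4 | n is used [lagrangian_exists]. Part (c) is the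
    handshake lemma. *)

(** * q-binomial sums and double counting *)

(** The q-binomial coefficient of m and k times q^(k(k-1)/2): since q^m - q^i
    vanishes for i = m, it is 0 for k > m. *)
Definition qbin (R : fieldType) (q : R) m k : R :=
  \prod_(i < k) ((q ^+ m - q ^+ i) / (q ^+ i.+1 - 1)).

Lemma qbinS (R : fieldType) (q : R) m k : (forall j, q ^+ j.+1 != 1) ->
  qbin q m.+1 k.+1 = qbin q m k.+1 + q ^+ m * qbin q m k.
Proof.
move=> q_neq1.
have shift : qbin q m.+1 k.+1
    = q ^+ k * (q ^+ m.+1 - 1) / (q ^+ k.+1 - 1) * qbin q m k.
  rewrite /qbin prodf_div big_ord_recl /= big_ord_recr /= prodf_div.
  under eq_bigr do rewrite /bump add1n !exprS -mulrBr.
  by rewrite big_split /= prodr_const card_ord expr0 invfM; ring.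
rewrite shift /qbin big_ord_recr /= -/(qbin q m k).
have := q_neq1 k; rewrite -subr_eq0 !exprS => qk.
by field.
Qed.

(** The q-binomial theorem prod_(i < m) (1 + q^i x) = sum_k qbin q m k x^k at
    x = 1, by the Pascal rule [qbinS]. *)
Lemma qbinomial_sum (R : fieldType) (q : R) m : (forall j, q ^+ j.+1 != 1) ->
  \sum_(k < m.+1) qbin q m k = \prod_(i < m) (1 + q ^+ i).
Proof.
move=> q_neq1; elim: m => [|m IH].
  by rewrite big_ord_recl !big_ord0 /qbin big_ord0 addr0.
rewrite [LHS]big_ord_recl; under eq_bigr => k _ do rewrite lift0 qbinS //.
rewrite big_split -mulr_sumr IH addrA [RHS]big_ord_recr /= mulrDr mulr1.
congr (_ + _); last exact: mulrC.
rewrite -IH [RHS]big_ord_recl big_ord_recr /=.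
have -> : qbin q m m.+1 = 0.
  by rewrite /qbin big_ord_recr /= subrr mul0r mulr0.
by rewrite addr0 /qbin !big_ord0.
Qed.

(** Factor by factor: both the numerator and the denominator on the right carry
    an extra power q^(m - 1 - i), which cancels. *)
Lemma qbin_alt (R : fieldType) (q : R) m k : q != 0 -> (k <= m)%N ->
  qbin q m k = (\prod_(0 <= i < k) (q ^+ (m.*2 - 1 - i) - q ^+ (m - 1)))
    / (\prod_(0 <= j < k) (q ^+ m - q ^+ (m - 1 - j))).
Proof.
move=> q_neq0 km; rewrite !big_mkord -prodf_div; apply: eq_bigr => i _.
have im : (i < m)%N := leq_trans (ltn_ord i) km.
have -> : q ^+ (m.*2 - 1 - i) - q ^+ (m - 1)
    = q ^+ (m - 1 - i) * (q ^+ m - q ^+ i).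
  by rewrite mulrBr -!exprD; congr (q ^+ _ - q ^+ _); lia.
have -> : q ^+ m - q ^+ (m - 1 - i) = q ^+ (m - 1 - i) * (q ^+ i.+1 - 1).
  by rewrite mulrBr mulr1 -exprD; congr (q ^+ _ - _); lia.
by rewrite -mulf_div divff ?mul1r // expf_neq0.
Qed.

(** The sizes a and c are elements of R rather than natural numbers, so that they
    can be quotients whose integrality is only a consequence of the count. *)
Lemma double_count (R : pzSemiRingType) (T U : finType)
    (S : {set T}) (A : {set U}) (r : T -> U -> bool) (a c : R) :
    (forall x, x \in S -> #|[set y in A | r x y]|%:R = a) ->
    (forall y, y \in A -> #|[set x in S | r x y]|%:R = c) ->
  #|S|%:R * a = #|A|%:R * c.
Proof.
move=> rowS colA.
transitivity (\sum_(x in S) \sum_(y in A | r x y) 1 : R).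
  rewrite mulr_natl -sumr_const; apply: eq_bigr => x /rowS <-.
  by rewrite -sum1_card natr_sum; apply: eq_bigl => y; rewrite inE.
rewrite (exchange_big_dep (mem A)) /=; last by move=> x y _ /andP [].
rewrite mulr_natl -sumr_const; apply: eq_bigr => y yA; rewrite -(colA y yA).
by rewrite -sum1_card natr_sum; apply: eq_bigl => x; rewrite inE yA.
Qed.

(** Each edge {x, y} is the set of ends of the two ordered pairs (x, y) and
    (y, x). *)
Lemma sum_degree (G : sgraph) : (\sum_(x : G) degree x = 2 * #|edges G|)%N.
Proof.
pose ends (p : G * G) := [set p.1; p.2].
rewrite (eq_bigr (fun x => \sum_(y : G | adj x y) 1)%N); last first.
  by move=> x _; rewrite /degree -sum1_card; apply: eq_bigl => y; rewrite inE.
rewrite pair_big_dep /= (partition_big ends (mem (edges G))) /=; last first.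
  by move=> p adjp; apply: imset_f; rewrite inE.
rewrite mulnC -sum_nat_const; apply: eq_bigr => _ /imsetP [[x y] /= adjxy ->].
rewrite inE in adjxy.
have neq_xy : x != y by apply: contraTneq adjxy => ->; rewrite adj_irr.
rewrite sum1_card.
transitivity #|[set (x, y); (y, x)]|; last first.
  by rewrite cards2 xpair_eqE (negPf neq_xy).
apply: eq_card => -[u v]; rewrite !inE /ends !xpair_eqE /=.
apply/andP/orP => [[adjuv /eqP eq_uv] | [] /andP [/eqP -> /eqP ->]].
- have /set2P u_xy : u \in [set x; y] by rewrite -eq_uv set21.
  have /set2P v_xy : v \in [set x; y] by rewrite -eq_uv set22.
  case: u_xy v_xy adjuv => -> [] ->; rewrite ?adj_irr // !eqxx;
    by [left | right].
- by rewrite adjxy.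
- by rewrite adj_sym adjxy setUC.
Qed.

(** * Lagrangians of a nondegenerate symmetric form *)

Section Orthogonal.

Variables (F : fieldType) (vT : vectType F) (f : {symmetric vT}).
Implicit Types (u v x y : vT) (U V W C D E : {vspace vT}).

Local Notation perp := (orthov f).
Local Notation "''[' u , v ]" := (f u%R v%R) : ring_scope.

Lemma form_sym u v : '[u, v] = '[v, u].
Proof. by rewrite hermC expr0 mul1r. Qed.

Lemma perpS U V : (U <= V)%VS -> (perp V <= perp U)%VS.
Proof.
move=> /subvP sUV; apply/subvP=> x /mem_orthovP xV.
by apply/mem_orthovP=> v /sUV /xV.
Qed.

Lemma perpD U V : perp (U + V) = (perp U :&: perp V)%VS.
Proof.
apply/eqP; rewrite eqEsubv subv_cap !perpS ?addvSl ?addvSr //=.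
by rewrite orthovD capvSl capvSr.
Qed.

Hypothesis f_nd : nondegenerate f.

(** One inequality holds for every form, since each vector of a basis of U cuts
    the dimension by at most one. Nondegeneracy gives the other by applying the
    first to U and to a complement of U, whose orthogonals meet in 0. *)
Lemma dim_perp U : (\dim (perp U) + \dim U = \dim {:vT})%N.
Proof.
have low V : (\dim {:vT} <= \dim (perp V) + \dim V)%N.
  rewrite -[V in perp V](span_basis (vbasisP V)).
  rewrite -[X in (_ + X)%N](size_tuple (vbasis V)).
  elim: (tval _) => [|x s IH] /=; first by rewrite span_nil orthov0 addn0.
  rewrite span_cons perpD capvC; have := leq_dim_orthov1 f x (perp <<s>>).
  move: IH; set p := \dim (perp <<s>>); case: p => [|p] /=; lia.
have := dimv_sum_cap (perp U) (perp U^C).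
have -> : (perp U :&: perp U^C)%VS = 0%VS.
  by rewrite -perpD addv_complf; apply/eqP.
have := dimvS (subvf (perp U + perp U^C)).
have := low U; have := low U^C%VS; have := dimvS (subvf U).
rewrite dimv_compl dimv0; lia.
Qed.

Lemma perpK U : perp (perp U) = U.
Proof.
apply/esym/eqP; rewrite eqEdim orthov_sym subvv /=.
have := dim_perp U; have := dim_perp (perp U); lia.
Qed.

Lemma perpI U V : perp (U :&: V) = (perp U + perp V)%VS.
Proof. by rewrite -[RHS]perpK perpD !perpK. Qed.

Definition lagrangian C := perp C == C.

Lemma lagrangian_form C x y :
  lagrangian C -> x \in C -> y \in C -> '[x, y] = 0.
Proof. by move=> /eqP defC; rewrite -{1}defC => /mem_orthovP; apply. Qed.

Lemma dim_lagrangian C : lagrangian C -> (\dim C).*2 = \dim {:vT}.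
Proof. by move=> /eqP defC; rewrite -(dim_perp C) defC addnn. Qed.

Lemma eq_dim_lagrangian C D : lagrangian C -> lagrangian D -> \dim C = \dim D.
Proof.
by move=> /dim_lagrangian dC /dim_lagrangian dD; apply: double_inj; lia.
Qed.

Lemma eq_lagrangian C D : lagrangian C -> lagrangian D -> (C <= D)%VS -> C = D.
Proof.
by move=> lC lD sCD; apply/eqP; rewrite eqEdim sCD (eq_dim_lagrangian lC lD) /=.
Qed.

(** For Lagrangians, dim C is also dim D, and the relation is symmetric. *)
Definition adjacent C D := (\dim (C :&: D)).+1 == \dim C.

Lemma adjacentC C D :
  lagrangian C -> lagrangian D -> adjacent C D = adjacent D C.
Proof. by move=> lC lD; rewrite /adjacent capvC (eq_dim_lagrangian lC lD). Qed.

(** Kneser's neighbour of D at an isotropic vector v. *)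
Definition neighbor D v := (D :&: perp <[v]> + <[v]>)%VS.

(** Taking orthogonals exchanges D :&: v^perp with D + <v>, so the claim is the
    modular law for <v> <= v^perp. *)
Lemma neighbor_lagrangian D v :
  lagrangian D -> '[v, v] = 0 -> lagrangian (neighbor D v).
Proof.
move=> /eqP defD v0; apply/eqP.
rewrite /neighbor perpD perpI perpK defD ![(_ :&: perp <[v]>)%VS]capvC.
by rewrite vspace_modr // orthov11 v0.
Qed.

Lemma mem_neighbor D v : v \in neighbor D v.
Proof. by rewrite memvE addvSr. Qed.

Lemma capv_neighbor D v :
  v \notin D -> (D :&: neighbor D v = D :&: perp <[v]>)%VS.
Proof.
move=> vD; rewrite /neighbor capvC -vspace_modl ?capvSl //.
suff -> : (<[v]> :&: D = 0)%VS by rewrite addv0.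
apply/eqP; rewrite -subv0; apply/subvP=> x /memv_capP [/vlineP [a ->]].
case: (eqVneq a 0) => [->|a0]; first by rewrite scale0r => _; apply: mem0v.
by rewrite rpredZeq (negPf a0) (negPf vD).
Qed.

Lemma neighbor_adjacent D v :
  lagrangian D -> v \notin D -> adjacent D (neighbor D v).
Proof.
move=> lD vD; rewrite /adjacent capv_neighbor // -eq_dim_orthov1.
  by rewrite prednK // lt0n dimv_eq0; apply: contraNneq vD => D0;
     rewrite -(eqP lD) D0 orthov0 memvf.
by rewrite (eqP lD).
Qed.

Section Pair.
Variables (D E : {vspace vT}).
Hypotheses (lD : lagrangian D) (lE : lagrangian E) (aDE : adjacent D E).

(** D :&: E is orthogonal to v, and it has the same dimension as the hyperplane
    D :&: v^perp of D. *)
Lemma adjacent_capv v :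
  v \in E -> v \notin D -> (D :&: E = D :&: perp <[v]>)%VS.
Proof.
move=> vE vD; apply/eqP; rewrite eqEdim subv_cap capvSl /=.
apply/andP; split.
  apply/subvP=> x /memv_capP [_ xE].
  by rewrite mem_orthov1 (lagrangian_form lE xE vE).
by rewrite -eq_dim_orthov1 ?(eqP lD) // -(eqP aDE).
Qed.

Lemma adjacent_mem v x :
  v \in E -> v \notin D -> x \in D -> '[x, v] = 0 -> x \in E.
Proof.
move=> vE vD xD xv; have : x \in (D :&: perp <[v]>)%VS.
  by rewrite memv_cap xD mem_orthov1 xv eqxx.
by rewrite -(adjacent_capv vE vD) => /memv_capP [].
Qed.

(** The neighbour construction reaches every Lagrangian adjacent to D, and from
    any of its vectors outside D; this is the uniqueness used in both counts. *)
Lemma adjacent_neighbor v : v \in E -> v \notin D -> E = neighbor D v.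
Proof.
move=> vE vD; apply/esym/eq_lagrangian => //.
  by apply: neighbor_lagrangian => //; apply: lagrangian_form lE _ _.
by rewrite /neighbor -(adjacent_capv vE vD) subv_add capvSr -memvE vE.
Qed.

End Pair.

(** Take x in C :&: D outside E. A vector y of C :&: E outside D would be
    orthogonal to x, as both lie in C; since D :&: E is D :&: y^perp, this would
    put x in E. Hence C :&: E is the trace on C :&: D of the hyperplane D :&: E
    of D, which does not contain C :&: D. *)
Lemma adjacent_step C D E : lagrangian C -> lagrangian D -> lagrangian E ->
    adjacent D E -> ~~ (C :&: D <= E)%VS ->
  (C :&: E <= D)%VS /\ (\dim (C :&: E)).+1 = \dim (C :&: D).
Proof.
move=> lC lD lE aDE nsCDE.
have sub : (C :&: E <= D)%VS.
  case/subvPn: nsCDE => x /memv_capP [xC xD] xE.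
  apply/subvP=> y /memv_capP [yC yE]; apply: contraNT xE => yD.
  exact: (adjacent_mem lD lE aDE yE yD xD (lagrangian_form lC xC yC)).
split=> //.
have -> : (C :&: E = (C :&: D) :&: E)%VS.
  by rewrite -capvA (capvC D) capvA (capv_idPl sub).
have := dimv_sum_cap (C :&: D) (D :&: E).
have -> : ((C :&: D) :&: (D :&: E) = (C :&: D) :&: E)%VS.
  by rewrite capvA -(capvA C) capvv.
suff -> : (C :&: D + D :&: E = D)%VS by rewrite -(eqP aDE); lia.
apply/eqP; rewrite eqEdim subv_add capvSr capvSl -(eqP aDE) ltnNge.
apply: contra nsCDE => dle.
have /eqP eqDE : (D :&: E == C :&: D + D :&: E)%VS by rewrite eqEdim addvSr.
by rewrite (subv_trans (addvSl _ (D :&: E))) // -eqDE capvSr.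
Qed.

Hypothesis two_neq0 : 2 != 0 :> F.

(** As v is not orthogonal to D, the function d |-> (v + d).(v + d), which is
    affine on D because D is isotropic, has a zero. *)
Lemma isotropic_translate D v : lagrangian D -> v \notin D ->
  exists2 d, d \in D & '[v + d, v + d] = 0.
Proof.
move=> lD; rewrite -{1}(eqP lD) => /mem_orthovPn [d dD vd].
exists (- ('[v, v] / (2 * '[v, d])) *: d); first exact: memvZ.
rewrite linearDl !linearDr /= !linearZl_LR !linearZr_LR /=.
rewrite (form_sym d v) (lagrangian_form lD dD dD).
by field; rewrite vd two_neq0.
Qed.

(** The neighbour of D at an isotropic vector of the coset v + D. *)
Lemma adjacent_sum_ex D v : lagrangian D -> v \notin D ->
  exists E, [/\ lagrangian E, adjacent D E & v \in (D + E)%VS].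
Proof.
move=> lD vD; have [d dD iso] := isotropic_translate lD vD.
have wD : v + d \notin D by rewrite rpredDr.
exists (neighbor D (v + d)); split.
- exact: neighbor_lagrangian.
- exact: neighbor_adjacent.
apply/memv_addP; exists (- d); first by rewrite memvN.
by exists (v + d); rewrite ?mem_neighbor // addrC addrK.
Qed.

(** Write v = d + e = d' + e'. Both e' = e + (d - d') and e are isotropic, so
    d - d' is orthogonal to e and therefore lies in E; then e' lies in E, and
    both E and E' are the neighbour of D at e'. *)
Lemma adjacent_sum_unique D E E' v : lagrangian D -> v \notin D ->
  lagrangian E -> adjacent D E -> v \in (D + E)%VS ->
  lagrangian E' -> adjacent D E' -> v \in (D + E')%VS -> E = E'.
Proof.
move=> lD vD lE aDE /memv_addP [d dD [e eE vE]].
move=> lE' aDE' /memv_addP [d' dD' [e' eE' vE']].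
have eD : e \notin D by move: vD; rewrite vE rpredDl.
have eD' : e' \notin D by move: vD; rewrite vE' rpredDl.
have de : e' = e + (d - d') by rewrite addrA [e + d]addrC -vE vE' addrC addKr.
have cD : d - d' \in D by rewrite rpredB.
move: (d - d') de cD => c de cD.
have : '[c, e] = 0.
  have := lagrangian_form lE' eE' eE'.
  rewrite {1 2}de linearDl !linearDr /= (lagrangian_form lE eE eE).
  rewrite (lagrangian_form lD cD cD) (form_sym e) add0r addr0 -mulr2n.
  by rewrite -mulr_natl => /eqP; rewrite mulf_eq0 (negPf two_neq0) => /eqP.
move=> /(adjacent_mem lD lE aDE eE eD cD) cE.
have e'E : e' \in E by rewrite de rpredD.
rewrite (adjacent_neighbor lD lE aDE e'E eD').
exact/esym/(adjacent_neighbor lD lE' aDE').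
Qed.

(** C + D is the orthogonal of C :&: D. Writing v = d + e, a vector of C :&: D
    is orthogonal to v if and only if it is orthogonal to e, that is, if and
    only if it lies in E. *)
Lemma adjacent_sum_step C D E v :
    lagrangian C -> lagrangian D -> lagrangian E ->
    adjacent D E -> v \in (D + E)%VS -> v \notin D ->
  (v \notin (C + D)%VS) = ~~ (C :&: D <= E)%VS.
Proof.
move=> lC lD lE aDE /memv_addP [d dD [e eE ->]].
have dCD : d \in (C + D)%VS by apply: (subvP (addvSr C D)).
rewrite (rpredDl e dD) (rpredDl e dCD) => eD.
congr (~~ _); rewrite -(eqP lC) -(eqP lD) -perpI !(eqP lC) !(eqP lD).
apply/mem_orthovP/subvP => [orth x xCD | sCDE x /sCDE xE].
  have [xC xD] := memv_capP xCD.
  by apply: (adjacent_mem lD lE aDE eE eD xD); rewrite form_sym orth.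
exact: lagrangian_form lE _ _.
Qed.

End Orthogonal.

(** * The size of the spheres around a Lagrangian *)

Lemma card_vspace_diff (F : finFieldType) n (U W : {vspace 'rV[F]_n}) :
  #|[set v in U | v \notin W]|%:R
  = #|F|%:R ^+ \dim U - #|F|%:R ^+ \dim (U :&: W) :> rat.
Proof.
have -> : [set v in U | v \notin W] = [set v in U] :\: [set v in W].
  by apply/setP=> v; rewrite !inE andbC.
have -> : #|F|%:R ^+ \dim U = #|[set v in U]|%:R :> rat.
  by rewrite cardsE card_vspace natrX.
have -> : #|F|%:R ^+ \dim (U :&: W)
    = #|[set v in U] :&: [set v in W]|%:R :> rat.
  rewrite -natrX -card_vspace; congr _%:R; apply: eq_card => v.
  by rewrite !inE memv_cap.
by rewrite -(cardsID [set v in W] [set v in U]) natrD addrC addKr.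
Qed.

Section Count.

Variables (F : finFieldType) (n : nat) (f : {symmetric 'rV[F]_n}).
Hypotheses (f_nd : nondegenerate f) (two_neq0 : 2 != 0 :> F).
Implicit Types (C D E : {vspace 'rV[F]_n}) (k : nat).

Local Notation q := (#|F|%:R : rat).

Definition sphere C k :=
  [set D | lagrangian f D && (\dim (C :&: D) + k == \dim C)%N].

Lemma sphere_stepP C D E k : lagrangian f C -> lagrangian f E ->
    D \in sphere C k -> adjacent D E ->
  (E \in sphere C k.+1) = ~~ (C :&: D <= E)%VS.
Proof.
move=> lC lE; rewrite !inE lE => /andP [lD /eqP dCD] aDE /=.
apply/eqP/idP => [dCE | /(adjacent_step f_nd lC lD lE aDE) [_]].
  apply: contraPN dCE => sCDE.
  have : (C :&: D <= C :&: E)%VS by rewrite subv_cap capvSl.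
  by move=> /dimvS; lia.
by move=> dCE; rewrite addnS -addSn dCE.
Qed.

(** Double count of the pairs (v, E) with v outside C + D and v in D + E. Each
    such v determines E; conversely, every vector of D + E outside D is outside
    C + D, by [adjacent_sum_step]. *)
Lemma card_sphere_up C D k : lagrangian f C -> D \in sphere C k ->
  #|[set E in sphere C k.+1 | adjacent D E]|%:R
  = (q ^+ (\dim C).*2 - q ^+ (\dim C + k)) / (q ^+ (\dim C).+1 - q ^+ \dim C).
Proof.
move=> lC sD; set m := \dim C.
have := sD; rewrite inE => /andP [lD /eqP dCD].
have dD : \dim D = m := eq_dim_lagrangian f_nd lD lC.
have q_gt1 : 1 < q by rewrite ltr1n; apply: finNzRing_gt1.
apply/esym/(canLR (mulfK _)).
  by rewrite subr_eq0 gt_eqF ?ltr_eXn2l.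
have -> : q ^+ m.*2 - q ^+ (m + k) = #|[set v | v \notin (C + D)%VS]|%:R.
  have -> : [set v | v \notin (C + D)%VS]
      = [set v : 'rV[F]_n in fullv | v \notin (C + D)%VS].
    by apply/setP=> v; rewrite !inE memvf.
  rewrite card_vspace_diff capfv -(dim_lagrangian f_nd lC).
  by have := dimv_sum_cap C D => dS; congr (_ - q ^+ _); lia.
rewrite -[LHS]mulr1.
apply: (double_count (r := fun v E => v \in (D + E)%VS)) => [v | E].
  rewrite inE => vCD.
  have vD : v \notin D by apply: contra vCD; apply/subvP/addvSr.
  have [E [lE aDE vE]] := adjacent_sum_ex f_nd two_neq0 lD vD.
  apply/eqP; rewrite pnatr_eq1; apply/cards1P; exists E.
  apply/setP=> E'; rewrite in_set1 !in_set; apply/idP/eqP.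
    case/andP=> /andP [/andP [lE' _] aDE'] vE'.
    exact: (adjacent_sum_unique f_nd two_neq0 lD vD).
  move=> ->; rewrite vE aDE !andbT.
  have := sphere_stepP lC lE sD aDE.
  by rewrite inE -(adjacent_sum_step f_nd lC lD lE aDE vE vD) => ->.
rewrite inE => /andP [sE aDE].
have lE : lagrangian f E by move: sE; rewrite inE => /andP [].
have nsub : ~~ (C :&: D <= E)%VS by rewrite -(sphere_stepP lC lE sD aDE).
rewrite (_ : [set _ in _ | _] = [set v in (D + E)%VS | v \notin D]); last first.
  apply/setP=> v; rewrite !inE andbC.
  case: (boolP (v \in (D + E)%VS)) => //= vE.
  apply/idP/idP => [|vD]; first by apply: contra; apply/subvP/addvSr.
  by rewrite (adjacent_sum_step f_nd lC lD lE aDE vE vD).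
rewrite card_vspace_diff (capv_idPr (addvSl D E)) dD.
suff -> : \dim (D + E) = m.+1 by [].
apply: (@addIn (\dim (D :&: E))); rewrite dimv_sum_cap addSnnS (eqP aDE) dD.
by rewrite (eq_dim_lagrangian f_nd lE lC).
Qed.

(** Double count of the pairs (v, D) with v in C outside E and v in D. Each such
    v is isotropic, being in C, and D is the neighbour of E at v; it is one step
    closer to C because it gains v while keeping C :&: E. *)
Lemma card_sphere_down C E k : lagrangian f C -> E \in sphere C k.+1 ->
  #|[set D in sphere C k | adjacent D E]|%:R
  = (q ^+ \dim C - q ^+ (\dim C - k.+1))
    / (q ^+ (\dim C - k) - q ^+ (\dim C - k.+1)).
Proof.
move=> lC sE; set m := \dim C.
have := sE; rewrite inE => /andP [lE /eqP dCE].
have q_gt1 : 1 < q by rewrite ltr1n; apply: finNzRing_gt1.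
have dCE' : \dim (C :&: E) = (m - k.+1)%N by rewrite /m; lia.
apply/esym/(canLR (mulfK _)).
  by rewrite subr_eq0 gt_eqF // ltr_eXn2l //; lia.
rewrite -[in LHS]dCE' -card_vspace_diff -[LHS]mulr1.
apply: (double_count (r := fun v D => v \in D)) => [v | D].
  rewrite inE => /andP [vC vE]; pose D := neighbor f E v.
  have lD : lagrangian f D.
    exact: (neighbor_lagrangian f_nd lE (lagrangian_form lC vC vC)).
  have aED : adjacent E D by apply: neighbor_adjacent.
  apply/eqP; rewrite pnatr_eq1; apply/cards1P; exists D.
  apply/setP=> D'; rewrite in_set1 !in_set; apply/idP/eqP => [|->].
    case/andP=> /andP [/andP [lD' _] aD'E] vD'.
    rewrite (adjacentC f_nd lD' lE) in aD'E.
    exact: (adjacent_neighbor f_nd lE lD' aD'E vD' vE).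
  rewrite mem_neighbor andbT lD (adjacentC f_nd lD lE) aED andbT /=.
  have nsub : ~~ (C :&: D <= E)%VS.
    by apply: contra vE => /subvP; apply; rewrite memv_cap vC mem_neighbor.
  rewrite (adjacentC f_nd lE lD) in aED.
  have [_ dCD] := adjacent_step f_nd lC lD lE aED nsub.
  by rewrite -dCD addSn -addnS dCE.
rewrite inE => /andP [sD aDE].
have := sD; rewrite inE => /andP [lD /eqP dCD].
have nsub : ~~ (C :&: D <= E)%VS by rewrite -(sphere_stepP lC lE sD aDE).
have [sCED _] := adjacent_step f_nd lC lD lE aDE nsub.
rewrite (_ : [set _ in _ | _]
    = [set v in (C :&: D)%VS | v \notin E]); last first.
  by apply/setP=> v; rewrite !inE memv_cap andbAC.
rewrite card_vspace_diff -capvA (capvC D) capvA (capv_idPl sCED) dCE'.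
by rewrite -[\dim (C :&: D)](addnK k) dCD.
Qed.

Lemma card_sphere0 C : lagrangian f C -> #|sphere C 0| = 1%N.
Proof.
move=> lC; rewrite (_ : sphere C 0 = [set C]) ?cards1 //.
apply/setP=> D; rewrite !inE addn0.
apply/andP/eqP => [[lD /eqP dCD] | ->]; last by rewrite lC capvv eqxx.
apply/esym/(eq_lagrangian f_nd lC lD).
by apply/capv_idPl/eqP; rewrite eqEdim capvSl dCD leqnn.
Qed.

Lemma card_sphere C k : lagrangian f C -> (k <= \dim C)%N ->
  #|sphere C k|%:R = qbin q (\dim C) k.
Proof.
move=> lC; elim: k => [|k IH] kC.
  by rewrite card_sphere0 // /qbin big_ord0.
have q_gt1 : 1 < q by rewrite ltr1n; apply: finNzRing_gt1.
have q_neq0 : q != 0 by rewrite gt_eqF // (lt_trans ltr01).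
have expq_neq1 j : q ^+ j.+1 - 1 != 0.
  by rewrite subr_eq0 gt_eqF // exprn_egt1.
have := double_count (fun D => @card_sphere_up C D k lC)
                     (fun E => @card_sphere_down C E k lC).
rewrite /qbin big_ord_recr /= -/(qbin _ _ _) IH 1?ltnW //; set P := qbin _ _ _.
have -> : \dim C = (k + (\dim C - k.+1).+1)%N by lia.
move: (\dim C - k.+1)%N => r.
have -> : (k + r.+1 - k = r.+1)%N by lia.
have -> : (k + r.+1 - k.+1 = r)%N by lia.
rewrite -addnn !(exprD, exprS).
have := expq_neq1 0%N; have := expq_neq1 k; rewrite expr1 exprS.
have := expf_neq0 k q_neq0; have := expf_neq0 r q_neq0; move: (q ^+ k) (q ^+ r).
(* a and b stand for q^k and q^(dim C - k - 1) *)
move=> a b b0 a0 aq1 q1.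
have bq1 : q * b - b != 0.
  by rewrite (_ : _ - _ = b * (q - 1)) ?mulf_neq0 //; ring.
have up_neq0 : q * (a * (q * b)) - a * (q * b) != 0.
  by rewrite (_ : _ - _ = a * (q * b) * (q - 1)) ?mulf_neq0 //; ring.
have down_neq0 : (a * (q * b) - b) / (q * b - b) != 0.
  rewrite mulf_neq0 ?invr_neq0 //.
  by rewrite (_ : _ - _ = b * (q * a - 1)) ?mulf_neq0 //; ring.
move=> eqN; apply: (mulIf down_neq0); rewrite -eqN.
by field; rewrite bq1 aq1 up_neq0.
Qed.

(** The spheres around C partition the Lagrangians. *)
Lemma card_lagrangian (C : {vspace 'rV[F]_n}) : lagrangian f C ->
  #|[set D | lagrangian f D]|%:R = \prod_(i < \dim C) (1 + #|F|%:R ^+ i) :> rat.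
Proof.
move=> lC; pose dist D : 'I_(\dim C).+1 := inord (\dim C - \dim (C :&: D)).
have q_neq1 j : #|F|%:R ^+ j.+1 != 1 :> rat.
  by rewrite gt_eqF // exprn_egt1 // ltr1n finNzRing_gt1.
rewrite -qbinomial_sum // -sum1_card natr_sum (partition_big dist predT) //=.
apply: eq_bigr => k _; rewrite -(card_sphere lC) -1?ltnS //.
rewrite -sum1_card natr_sum; apply: eq_bigl => D; rewrite !inE.
congr (_ && _); rewrite -val_eqE /= inordK; last by rewrite ltnS leq_subr.
have := dimvS (capvSl C D); have := ltn_ord k; move: (nat_of_ord k).
move: (\dim C) (\dim _) => a b j; lia.
Qed.

End Count.

(** * Type III codes are the Lagrangians of the dot product *)

Fact inner_is_bilinear n : bilinear_for
  (GRing.Scale.Law.clone _ _ *%R _) (GRing.Scale.Law.clone _ _ (idfun \; *%R) _)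
  (@inner n).
Proof.
split=> [v | v] a u w.
  rewrite /= /inner mulr_sumr -big_split; apply: eq_bigr => i _.
  by rewrite !mxE mulrDl mulrA.
rewrite /= /inner mulr_sumr -big_split; apply: eq_bigr => i _.
by rewrite !mxE mulrDr mulrCA.
Qed.

HB.instance Definition _ n :=
  bilinear_isBilinear.Build _ _ _ _ _ _ (@inner n) (@inner_is_bilinear n).

Fact inner_is_symmetric n (u v : 'rV['F_3]_n) :
  inner u v = (-1) ^+ false * idfun (inner v u).
Proof. by rewrite expr0 mul1r; apply: eq_bigr => i _; rewrite mulrC. Qed.

HB.instance Definition _ n :=
  isHermitianSesquilinear.Build _ _ _ _ (@inner n) (@inner_is_symmetric n).

Definition dot n : {symmetric 'rV['F_3]_n} := @inner n.

Lemma innerE n (u v : 'rV['F_3]_n) : inner u v = (u *m v^T) 0 0.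
Proof. by rewrite mxE; apply: eq_bigr => i _; rewrite mxE. Qed.

Lemma inner_nondegenerate n : nondegenerate (dot n).
Proof.
rewrite /nondegenerate -subv0; apply/subvP=> v /mem_orthovP v_orth.
rewrite memv0; apply/eqP/rowP=> i; rewrite [RHS]mxE.
rewrite -(v_orth (delta_mx 0 i) (memvf _)) /= innerE trmx_delta -colE.
by rewrite !mxE.
Qed.

Lemma self_dualE n (C : code n) : self_dual C = lagrangian (dot n) C.
Proof.
rewrite /self_dual /lagrangian eq_sym; apply/eqP/eqP => [/setP dualC | perpC].
  apply/vspaceP => v; have := dualC v; rewrite !inE => <-.
  apply/mem_orthovP/forall_inP => orth u uC.
    by rewrite (form_sym (dot n)) orth.
  by rewrite [LHS](form_sym (dot n)); apply/eqP/orth.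
apply/setP=> v; rewrite !inE -[in RHS]perpC.
apply/forall_inP/mem_orthovP => orth u uC.
  by rewrite [LHS](form_sym (dot n)); apply/eqP/orth.
by rewrite (form_sym (dot n)) orth.
Qed.

(** The nonzero elements of F_3 are 1 and -1, both of square 1. *)
Lemma inner_weight n (v : 'rV['F_3]_n) : inner v v = (weight v)%:R.
Proof.
rewrite /inner /weight -sum1_card natr_sum [RHS]big_mkcond.
apply: eq_bigr => i _; rewrite inE.
by case: (v 0 i) => [[|[|[|]]]] // lt_i3; apply: val_inj.
Qed.

Lemma typeIIIE n (C : code n) : typeIII C = lagrangian (dot n) C.
Proof.
rewrite /typeIII self_dualE; apply: andb_idr => lC.
apply/forall_inP=> v vC; have := lagrangian_form lC vC vC.
by rewrite /= inner_weight => /eqP; rewrite -(dvdn_pcharf (pchar_Fp _)).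
Qed.

(** The symmetric matrix B = [1, 1; 1, -1] satisfies B *m B = 2 = -1 over F_3,
    so u |-> uB multiplies the dot product by -1 and its graph is totally
    isotropic of half the dimension. For l = 1 this is the tetracode. *)
Lemma lagrangian_exists l :
  exists C : code (l + l + (l + l)), lagrangian (dot _) C.
Proof.
pose B : 'M['F_3]_(l + l) := block_mx 1%:M 1%:M 1%:M (- 1%:M).
have trB : B^T = B by rewrite tr_block_mx linearN /= !trmx1.
have BB : B *m B = - 1%:M.
  rewrite mulmx_block !(mul1mx, mulmx1, mulmxN, mulNmx, opprK) subrr.
  rewrite [RHS](_ : _ = block_mx (- 1%:M) 0 0 (- 1%:M)).
    congr block_mx; rewrite -mulr2n -scaler_nat -scaleN1r;
    by congr (_ *: _); apply: val_inj.
  by rewrite scalar_mx_block opp_block_mx !oppr0.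
pose g : 'M['F_3]_(l + l, l + l + (l + l)) := row_mx 1%:M B.
pose C := limg (linfun (mulmxr g : 'rV__ -> 'rV__)).
have memC v : reflect (exists u : 'rV_(l + l), v = row_mx u (u *m B)) (v \in C).
  apply: (iffP memv_imgP) => [[u _ ->] | [u ->]]; exists u; rewrite ?memvf //.
    by rewrite lfunE /= mul_mx_row mulmx1.
  by rewrite lfunE /= mul_mx_row mulmx1.
exists C; apply/eqP/vspaceP => v.
apply/mem_orthovP/memC => [orth | [u ->] w /memC [x ->]].
  exists (lsubmx v); rewrite -[LHS]hsubmxK; congr row_mx.
  have vB : lsubmx v + rsubmx v *m B = 0.
    apply/rowP=> i; rewrite [RHS]mxE.
    have /orth /= : row_mx (delta_mx 0 i) (delta_mx 0 i *m B) \in C.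
      by apply/memC; exists (delta_mx 0 i).
    rewrite innerE -{1}[v]hsubmxK tr_row_mx mul_row_col trmx_mul trB trmx_delta.
    by rewrite mulmxA -mulmxDl -colE mxE.
  have -> : lsubmx v = - (rsubmx v *m B).
    by apply/esym/addr0_eq; rewrite addrC.
  by rewrite mulNmx -mulmxA BB mulmxN mulmx1 opprK.
rewrite /= innerE tr_row_mx mul_row_col trmx_mul trB mulmxA -(mulmxA u) BB.
by rewrite mulmxN mulmx1 mulNmx subrr mxE.
Qed.

(** * The graph *)

Lemma dim_typeIII n (C : typeIII_code n) : \dim (val C) = n./2.
Proof.
have := valP C; rewrite /= typeIIIE.
move=> /(dim_lagrangian (inner_nondegenerate n)).
by rewrite dimvf [dim _]mul1n => /(congr1 half); rewrite doubleK.
Qed.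

Lemma degreeE n k (C : GammaIII n k) : (0 < k)%N ->
  degree C = #|sphere (dot n) (val C) k|.
Proof.
move=> k_gt0; rewrite /degree -(card_imset _ val_inj); apply: eq_card => D.
rewrite inE; apply/imsetP/andP => [[E] | [lD dCD]].
  rewrite inE => /andP [_ nCE] ->; split; first by rewrite -typeIIIE (valP E).
  by rewrite dim_typeIII.
have tD : typeIII D by rewrite typeIIIE.
exists (Sub D tD) => //; rewrite inE; apply/andP; split; last first.
  by rewrite /k_neighbors SubK -(dim_typeIII C).
apply: contraTneq dCD => ->; rewrite SubK capvv -[X in _ != X]addn0 eqn_add2l.
by rewrite -lt0n.
Qed.

Lemma F3_two_neq0 : 2 != 0 :> 'F_3.
Proof. by []. Qed.

Lemma card_typeIII n : (n %% 4 = 0)%N -> (0 < n)%N ->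
  #|typeIII_code n| = (2 * \prod_(1 <= i < n./2) (3 ^ i + 1))%N.
Proof.
move=> n4 n_gt0.
have -> : #|typeIII_code n| = #|[set D | lagrangian (dot n) D]|.
  by rewrite card_sig; apply: eq_card => D; rewrite !inE -typeIIIE.
have [C lC] : exists C, lagrangian (dot n) C.
  have [C lC] := lagrangian_exists (n %/ 4).
  have en : n = (n %/ 4 + n %/ 4 + (n %/ 4 + n %/ 4))%N by lia.
  by move: C lC; rewrite -en => C; exists C.
have tC : typeIII C by rewrite typeIIIE.
apply/eqP; rewrite -(eqr_nat rat).
rewrite (card_lagrangian (inner_nondegenerate n) F3_two_neq0 lC).
rewrite (dim_typeIII (Sub C tC : typeIII_code n)) card_Fp //.
have [m ->] : exists m, n./2 = m.+1 by exists n./2.-1; lia.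
rewrite -(big_mkord predT (fun i => 1 + 3 ^+ i)) natrM natr_prod.
rewrite [X in X == _]big_ltn //.
apply/eqP; congr (_ * _); apply: eq_bigr => i _.
by rewrite natrD natrX addrC.
Qed.

Theorem theorem6p2 (n k : nat) (n_gt0 : (0 < n)%N) (n_mod4 : (n = 0 %[mod 4])%N)
    (k_gt0 : (1 <= k)%N) (k_le : (k <= n./2)%N) :
  [/\ #|GammaIII n k| = (2 * \prod_(1 <= i < n./2) (3 ^ i + 1))%N,
      exists2 d : nat, regular (GammaIII n k) d &
        d%:R = (\prod_(0 <= i < k) (3%:R ^+ (n - 1 - i)%N - 3%:R ^+ (n./2 - 1)%N))
             / (\prod_(0 <= j < k) (3%:R ^+ n./2 - 3%:R ^+ (n./2 - 1 - j)%N)) :> rat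
    & #|edges (GammaIII n k)|%:R =
        (\prod_(1 <= i < n./2) (3%:R ^+ i + 1))
        * ((\prod_(0 <= i < k) (3%:R ^+ (n - 1 - i)%N - 3%:R ^+ (n./2 - 1)%N))
          / (\prod_(0 <= j < k) (3%:R ^+ n./2 - 3%:R ^+ (n./2 - 1 - j)%N))) :> rat].
Proof.
set delta := _ / _.
have cardV : #|GammaIII n k| = (2 * \prod_(1 <= i < n./2) (3 ^ i + 1))%N.
  exact: card_typeIII.
have deltaE : delta = qbin 3 n./2 k.
  by rewrite qbin_alt // (_ : n./2.*2 = n); last lia.
have deg (C : GammaIII n k) : (degree C)%:R = delta.
  have lC : lagrangian (dot n) (val C) by rewrite -typeIIIE (valP C).
  rewrite degreeE // (card_sphere (inner_nondegenerate n) F3_two_neq0 lC).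
    by rewrite dim_typeIII card_Fp.
  by rewrite dim_typeIII.
have /card_gt0P [C _] : (0 < #|GammaIII n k|)%N.
  by rewrite cardV muln_gt0 prodn_gt0 // => i; rewrite addn1.
have reg : regular (GammaIII n k) (degree C).
  by move=> D; apply/eqP; rewrite -(eqr_nat rat) !deg.
split=> //; first by exists (degree C).
have := sum_degree (GammaIII n k).
rewrite (eq_bigr (fun=> degree C)) // sum_nat_const cardV -mulnA => /eqP.
rewrite eqn_pmul2l // => /eqP <-; rewrite natrM deg natr_prod; congr (_ * _).
by apply: eq_bigr => i _; rewrite natrD natrX.
Qed.
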